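(* Let $X$ be an order complete atomic Banach lattice represented as an order dense ideal in $\mathbb R^A$, where $A$ is a maximal collection of pairwise disjoint atoms of $X$. For every net $(y_\alpha)$ in $\mathbb R^A$, if $(y_\alpha)$ un-converges to $0$ with respect to $X$, then $y_\alpha\to 0$ point-wise on $A$. The converse (that every net in $\mathbb R^A$ converging to $0$ point-wise un-converges to $0$ with respect to $X$) is true if and only if $X$ is order continuous.
   Context: All vector lattices are Archimedean. An atom of a vector lattice $E$ is a non-zero positive vector $a$ whose principal ideal $I_a$ equals the span of $a$; then $I_a$ is a projection band, with band projection $P_a x=\varphi_a(x)a$, where $\varphi_a$ is the coordinate functional of $a$. $E$ is atomic if it equals the band generated by all its atoms. If $E$ is atomic and $A$ is a maximal collection of pairwise disjoint atoms, then $x\mapsto(\varphi_a(x))_{a\in A}$ is a lattice isomorphism of $E$ onto an order dense sublattice of $\mathbb R^A$, which is an ideal of $\mathbb R^A$ when $E$ is order complete; one identifies $E$ with its image (this is the representation meant in the claim). Order dense: every non-zero positive $y$ in the big lattice dominates some $x$ in the sublattice with $0<x\le y$. A Banach lattice $X$ is order continuous if $x_\alpha\downarrow 0$ in $X$ implies $\|x_\alpha\|\to 0$. For a normed lattice $X$ that is an ideal in a vector lattice $Y$, a net $(y_\alpha)$ in $Y$ un-converges to $y\in Y$ with respect to $X$ if $\bigl\||y_\alpha-y|\wedge x\bigr\|_X\to 0$ for every $x\in X_+$; here $Y=\mathbb R^A$. *)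

(* Defs.v *)
From HB Require Import structures.
From mathcomp Require Import all_boot all_order all_algebra.
From mathcomp Require Import all_classical all_reals all_analysis.

Set Implicit Arguments.
Unset Strict Implicit.
Unset Printing Implicit Defensive.

Import Order.TTheory GRing.Theory Num.Theory.
Import numFieldNormedType.Exports.

Local Open Scope classical_set_scope.
Local Open Scope ring_scope.

(* The order is a field of its own rather than an Order.Lattice instance:
   since Num.NumDomain is already declared, Hierarchy Builder rejects a new
   structure that joins an Order structure with a normed module. *)
HB.mixin Record isVectorLattice (R : realType) X of GRing.Lmodule R X := {
  vle : rel X;
  vsup : X -> X -> X;
  vinf : X -> X -> X;
  vle_refl : reflexive vle;
  vle_anti : antisymmetric vle;
  vle_trans : transitive vle;
  vsup_le : forall x y z : X, vle (vsup x y) z = vle x z && vle y z;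
  le_vinf : forall x y z : X, vle z (vinf x y) = vle z x && vle z y;
  vle_add2r : forall z x y : X, vle x y -> vle (x + z) (y + z);
  vle_scale : forall (c : R) (x y : X),
    0 <= c -> vle x y -> vle (c *: x) (c *: y) }.

#[short(type="vectorLatticeType")]
HB.structure Definition VectorLattice (R : realType) :=
  { X of GRing.Lmodule R X & isVectorLattice R X }.

Notation "x <=v y" := (vle x y) (at level 70, y at next level).

(* The lattice modulus; the library notation `|x| is the (real) norm of x. *)
Definition modulus (R : realType) (X : vectorLatticeType R) (x : X) : X :=
  vsup x (- x).

(* A lattice norm makes X Archimedean, so this is not required separately. *)
HB.mixin Record hasLatticeNorm (R : realType) X
    of VectorLattice R X & NormedModule R X := {
  norm_le_modulus : forall x y : X,
    modulus x <=v modulus y -> `|x| <= `|y| }.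

#[short(type="banachLatticeType")]
HB.structure Definition BanachLattice (R : realType) :=
  { X of VectorLattice R X & CompleteNormedModule R X & hasLatticeNorm R X }.

Section VectorLatticeNotions.
Context {R : realType} {X : vectorLatticeType R}.
Implicit Types (x y z a : X) (A B S : set X).

Definition disjoint x y : Prop := vinf (modulus x) (modulus y) = 0.

Definition upper_bound S x : Prop := forall y, S y -> y <=v x.

Definition lower_bound S x : Prop := forall y, S y -> x <=v y.

Definition is_sup S s : Prop :=
  upper_bound S s /\ forall x, upper_bound S x -> s <=v x.

Definition is_inf S s : Prop :=
  lower_bound S s /\ forall x, lower_bound S x -> x <=v s.

(* Dedekind completeness: nonempty order bounded above sets have a supremum. *)
Definition order_complete : Prop :=
  forall S, S !=set0 -> upper_bound S !=set0 -> exists s, is_sup S s.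

Definition is_ideal B : Prop :=
  [/\ B 0,
      forall x y, B x -> B y -> B (x + y),
      forall (c : R) x, B x -> B (c *: x) &
      forall x y, modulus x <=v modulus y -> B y -> B x].

Definition is_band B : Prop :=
  is_ideal B /\ forall S s, S `<=` B -> is_sup S s -> B s.

Definition principal_ideal a : set X :=
  [set x | exists2 c : R, 0 <= c & modulus x <=v c *: modulus a].

Definition is_atom a : Prop :=
  [/\ a != 0, 0 <=v a & principal_ideal a = range (fun c : R => c *: a)].

Definition is_band_projection B x p : Prop :=
  B p /\ forall z, B z -> disjoint (x - p) z.

(* The value phi_a(x): for an atom a of an Archimedean X, the unique c such that c *: a is the projection of
   x onto the band I_a. *)
Definition coord a x : R :=
  get [set c : R | is_band_projection (principal_ideal a) x (c *: a)].

Definition pairwise_disjoint_atoms A : Prop :=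
  A `<=` is_atom /\ forall a b, A a -> A b -> a <> b -> disjoint a b.

Definition maximal_disjoint_atoms A : Prop :=
  pairwise_disjoint_atoms A /\
  forall B, pairwise_disjoint_atoms B -> A `<=` B -> B = A.

(* The representation of X in R^A. *)
Definition atomic_repr A x : A -> R := fun t => coord (val t) x.

End VectorLatticeNotions.

Arguments order_complete {R} X.
Arguments atomic_repr {R X} A x _.

Definition atomic (R : realType) (X : vectorLatticeType R) : Prop :=
  smallest (@is_band R X) (@is_atom R X) = setT.

Record directedSet := DirectedSet {
  dcarrier :> Type;
  dle : dcarrier -> dcarrier -> Prop;
  dinhab : inhabited dcarrier;
  dle_refl : forall i, dle i i;
  dle_trans : forall i j k, dle i j -> dle j k -> dle i k;
  dle_ub : forall i j, exists2 k, dle i k & dle j k }.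

Definition tails (D : directedSet) : set_system D :=
  [set S | exists i, forall j, dle i j -> S j].
Arguments tails D _ : clear implicits.

Definition order_continuous (R : realType) (X : banachLatticeType R) : Prop :=
  forall (D : directedSet) (x : D -> X),
    (forall i j, dle i j -> x j <=v x i) ->
    is_inf (range x) 0 ->
    `|x i| @[i --> tails D] --> (0 : R).

Definition pointwise_cvg (R : realType) (T : Type) (D : directedSet)
    (y : D -> T -> R) (l : T -> R) : Prop :=
  forall t, y i t @[i --> tails D] --> l t.

(* un-convergence in R^A with respect to X. The vector |y_i - l| /\ x of R^A
   is an element of X through [atomic_repr A]: it is represented by z i, and its
   X-norm is `|z i|. *)
Definition un_cvg (R : realType) (X : banachLatticeType R) (A : set X)
    (D : directedSet) (y : D -> A -> R) (l : A -> R) : Prop :=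
  forall x : X, 0 <=v x ->
    exists2 z : D -> X,
      (forall i, atomic_repr A (z i) =
                 (fun a : A => Num.min `|y i a - l a| (atomic_repr A x a))) &
      `|z i| @[i --> tails D] --> (0 : R).

(* Main.v *)
Require Import Defs.
From HB Require Import structures.
From mathcomp Require Import all_boot all_order all_algebra.
From mathcomp Require Import all_classical all_reals all_analysis.

(** The coordinate functionals of the atoms in A are linear and positive, and
    together they embed X into R^A with three properties that carry the whole
    proof.

    - For x >= 0 the coordinate at a is the largest c with c a <= x
      ([coord_exists_pos]), so in particular [coord a x *: a] lies below x.
    - The embedding reflects the order ([coord_reflect_le]). A vector that is
      disjoint from every element of A is 0, since its disjoint complement is
      a band that contains all atoms; applied to the negative part of a vector
      with positive coordinates, this gives positivity.
    - The image is an ideal of R^A ([coord_solid]): by order completeness a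
      family 0 <= f <= x of coordinates is that of the supremum of the vectors
      f(a) a.

    Un-convergence tested on the vector a is convergence of the coordinate at
    a, which gives the first claim.

    If X is order continuous, x >= 0 and (y_i) tends to 0 pointwise, then the
    finite sections of x approximate x in norm, as the remainders x - x_s
    decrease to 0 along the finite subsets s of A. The inequality
    |y_i| /\ x <= (x - x_s) + sum_(a in s) |y_i(a)| a then bounds the norm of
    the left-hand side by a small constant plus finitely many terms that tend
    to 0.

    Conversely, a net (x_i) that decreases to 0 in order decreases to 0 in
    each coordinate, hence un-converges to 0 when pointwise convergence implies
    un-convergence. Beyond an index j one has x_i /\ x_j = x_i, so testing on
    x_j gives convergence in norm. *)

Set Implicit Arguments.
Unset Strict Implicit.
Unset Printing Implicit Defensive.

Import Order.TTheory GRing.Theory Num.Theory.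
Import numFieldNormedType.Exports.

Local Open Scope classical_set_scope.
Local Open Scope ring_scope.

Local Notation disjoint := Defs.disjoint.
Local Notation coord := Defs.coord.

(** * Vector lattices and disjointness *)

Section VectorLatticeTheory.
Context {R : realType} {X : vectorLatticeType R}.
Implicit Types (a b s u v w x y z : X) (c d k t : R).

Lemma vle_subr_ge0 x y : (0 <=v y - x) = (x <=v y).
Proof.
apply/idP/idP => [/(vle_add2r x)|/(vle_add2r (- x))].
  by rewrite add0r subrK.
by rewrite subrr.
Qed.

Lemma vleBlDr x y z : (x - y <=v z) = (x <=v z + y).
Proof. by rewrite -vle_subr_ge0 -[RHS]vle_subr_ge0 opprB addrA. Qed.

Lemma vleBrDr x y z : (x <=v y - z) = (x + z <=v y).
Proof. by rewrite -[RHS]vle_subr_ge0 -vle_subr_ge0 opprD addrA addrAC. Qed.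

Lemma vle_addl x y : (x <=v x + y) = (0 <=v y).
Proof. by rewrite -vle_subr_ge0 addrAC subrr add0r. Qed.

Lemma vle_subl_self x y : (x <=v x - y) = (y <=v 0).
Proof. by rewrite -vle_subr_ge0 addrAC subrr vle_subr_ge0. Qed.

Lemma vleN2 x y : (- x <=v - y) = (y <=v x).
Proof. by rewrite -vle_subr_ge0 opprK addrC vle_subr_ge0. Qed.

Lemma vle_add x y z w : x <=v y -> z <=v w -> x + z <=v y + w.
Proof.
move=> xy zw; apply: (vle_trans (y + z)); first exact: vle_add2r.
by rewrite addrC [y + w]addrC; apply: vle_add2r.
Qed.

Lemma vle_eq x y : x <=v y -> y <=v x -> x = y.
Proof. by move=> xy yx; apply: vle_anti; rewrite xy. Qed.

Lemma vscale_ge0 c x : 0 <= c -> 0 <=v x -> 0 <=v c *: x.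
Proof. by move=> c0 /(vle_scale c _ _ c0); rewrite scaler0. Qed.

Lemma vle_scale_coef c d x : 0 <=v x -> c <= d -> c *: x <=v d *: x.
Proof.
move=> x0 cd; rewrite -vle_subr_ge0 -scalerBl.
by apply: vscale_ge0; rewrite ?subr_ge0.
Qed.

Lemma vscale_lt0_eq0 c x : c < 0 -> 0 <=v x -> 0 <=v c *: x -> x = 0.
Proof.
move=> c0 x0 cx0; apply: vle_eq => //.
have := vscale_ge0 (c := - c^-1) _ cx0; rewrite scalerA mulNr mulVf ?lt_eqF//.
by rewrite scaleN1r -[x <=v 0]vleN2 oppr0; apply; rewrite oppr_ge0 invr_le0 ltW.
Qed.

Lemma vle_supl x y : x <=v vsup x y.
Proof. by have := vle_refl (vsup x y); rewrite vsup_le => /andP[]. Qed.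

Lemma vle_supr x y : y <=v vsup x y.
Proof. by have := vle_refl (vsup x y); rewrite vsup_le => /andP[]. Qed.

Lemma modulus_ge0 x : 0 <=v modulus x.
Proof.
have := vle_add (vle_supl x (- x)) (vle_supr x (- x)).
rewrite subrr -mulr2n -scaler_nat => h.
have := vle_scale 2^-1 _ _ _ h.
rewrite scaler0 scalerA mulVf ?pnatr_eq0// scale1r; apply.
by rewrite invr_ge0 ler0n.
Qed.

Lemma modulus_le x y : (modulus x <=v y) = (x <=v y) && (- x <=v y).
Proof. exact: vsup_le. Qed.

Lemma modulus_id x : 0 <=v x -> modulus x = x.
Proof.
move=> x0; apply: vle_eq; last exact: vle_supl.
rewrite modulus_le vle_refl /=; apply: (vle_trans 0) => //.
by rewrite -oppr0 vleN2.
Qed.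

Lemma modulusD x y : modulus (x + y) <=v modulus x + modulus y.
Proof.
rewrite modulus_le opprD.
by apply/andP; split; apply: vle_add; rewrite ?vle_supl ?vle_supr.
Qed.

Lemma modulusZ c x : modulus (c *: x) <=v `|c| *: modulus x.
Proof.
have [c0|c0] := ger0P c; rewrite modulus_le.
  rewrite -scalerN; apply/andP; split; apply: vle_scale => //;
    [exact: vle_supl | exact: vle_supr].
rewrite -scaleNr.
have -> : c *: x = - c *: - x by rewrite scalerN scaleNr opprK.
by apply/andP; split; apply: vle_scale; rewrite ?oppr_ge0 ?ltW//;
  [exact: vle_supr | exact: vle_supl].
Qed.

Definition pos_part x := vsup x 0.
Definition neg_part x := vsup (- x) 0.

Lemma pos_part_ge0 x : 0 <=v pos_part x. Proof. exact: vle_supr. Qed.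
Lemma neg_part_ge0 x : 0 <=v neg_part x. Proof. exact: vle_supr. Qed.
Lemma pos_part_ge x : x <=v pos_part x. Proof. exact: vle_supl. Qed.

Lemma pos_part_le x y : x <=v y -> 0 <=v y -> pos_part x <=v y.
Proof. by rewrite /pos_part vsup_le => -> ->. Qed.

Lemma neg_part_le x y : - x <=v y -> 0 <=v y -> neg_part x <=v y.
Proof. by rewrite /neg_part vsup_le => -> ->. Qed.

Lemma pos_part_modulus x : pos_part x <=v modulus x.
Proof. by apply: pos_part_le (modulus_ge0 x); apply: vle_supl. Qed.

Lemma neg_part_modulus x : neg_part x <=v modulus x.
Proof. by apply: neg_part_le (modulus_ge0 x); apply: vle_supr. Qed.

Lemma pos_part_subr x : pos_part x - neg_part x = x.
Proof.
apply: vle_eq.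
  rewrite vleBlDr; apply: pos_part_le; first by rewrite vle_addl ?neg_part_ge0.
  by rewrite addrC -[x]opprK vle_subr_ge0 opprK vle_supl.
rewrite -vleN2 opprB vleBlDr; apply: neg_part_le.
  by rewrite vle_addl ?pos_part_ge0.
by rewrite addrC vle_subr_ge0 pos_part_ge.
Qed.

Lemma disjoint_le x y w :
  disjoint x y -> w <=v modulus x -> w <=v modulus y -> w <=v 0.
Proof. by move=> <- wx wy; rewrite le_vinf wx. Qed.

(** Testing positive vectors is enough: a common lower bound of the two moduli
    can be replaced by its positive part. *)
Lemma disjoint_intro x y :
  (forall w, 0 <=v w -> w <=v modulus x -> w <=v modulus y -> w <=v 0) ->
  disjoint x y.
Proof.
move=> h; apply: vle_eq; last by rewrite le_vinf !modulus_ge0.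
set i := vinf _ _.
have /andP[ix iy] : (i <=v modulus x) && (i <=v modulus y).
  by rewrite -le_vinf vle_refl.
apply: vle_trans (pos_part_ge i) _.
by apply: h; rewrite ?pos_part_ge0//; apply: pos_part_le; rewrite ?modulus_ge0.
Qed.

Lemma disjoint_sym x y : disjoint x y -> disjoint y x.
Proof.
move=> xy; apply: disjoint_intro => w _ wy wx; exact: disjoint_le xy wx wy.
Qed.

Lemma disjoint_self x : disjoint x x -> x = 0.
Proof.
move=> xx; have m0 := disjoint_le xx (vle_refl _) (vle_refl _).
move: m0; rewrite modulus_le => /andP[x0]; rewrite -[X in _ <=v X]oppr0 vleN2 => ?.
exact: vle_eq.
Qed.

Lemma disjoint_solid x y z :
  modulus x <=v modulus y -> disjoint y z -> disjoint x z.
Proof.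
move=> xy yz; apply: disjoint_intro => w _ wx wz.
by apply: disjoint_le yz _ wz; apply: vle_trans xy.
Qed.

Lemma disjoint0 x : disjoint 0 x.
Proof. by apply: disjoint_intro => w _; rewrite modulus_id ?vle_refl. Qed.

Lemma disjointD x y z : disjoint x z -> disjoint y z -> disjoint (x + y) z.
Proof.
move=> xz yz; apply: disjoint_intro => w _ wxy wz.
have wx : w <=v modulus x.
  rewrite -[modulus x]add0r -vleBlDr; apply: disjoint_le yz _ _.
    by rewrite vleBlDr addrC; apply: vle_trans (modulusD x y).
  rewrite vleBlDr; apply: vle_trans wz _.
  by rewrite -[X in X <=v _]addr0; apply: vle_add (vle_refl _) (modulus_ge0 x).
exact: disjoint_le xz wx wz.
Qed.

Lemma disjointZ c x z : disjoint x z -> disjoint (c *: x) z.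
Proof.
move=> xz; apply: disjoint_intro => w w0 wx wz.
have k1 : 1 <= `|c| + 1 by rewrite lerDr.
have k0 : 0 < `|c| + 1 by apply: lt_le_trans k1.
(* Scaling down by |c| + 1 brings w below |x| and keeps it below |z|. *)
have wV : (`|c| + 1)^-1 *: w <=v 0.
  apply: disjoint_le xz _ _.
    have := vle_scale (`|c| + 1)^-1 w ((`|c| + 1) *: modulus x).
    rewrite scalerA mulVf ?gt_eqF// scale1r; apply; first by rewrite invr_ge0 ltW.
    apply: vle_trans wx _; apply: vle_trans (modulusZ c x) _.
    by apply: vle_scale_coef; rewrite ?modulus_ge0// lerDl.
  apply: vle_trans wz; rewrite -[X in _ <=v X]scale1r.
  by apply: vle_scale_coef; rewrite // invf_le1.
have := vle_scale (`|c| + 1) _ _ (ltW k0) wV.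
by rewrite scalerA mulfV ?gt_eqF// scale1r scaler0.
Qed.

Lemma disjointB x y z : disjoint x z -> disjoint y z -> disjoint (x - y) z.
Proof. by move=> xz yz; rewrite -scaleN1r; apply/disjointD/disjointZ. Qed.

Lemma disjoint_pos_neg x : disjoint (pos_part x) (neg_part x).
Proof.
apply: disjoint_intro => w _.
rewrite !modulus_id ?pos_part_ge0 ?neg_part_ge0// => wp wn.
(* w can be subtracted from both parts of x, and x^+ is the least positive
   vector above x. *)
have : pos_part x <=v pos_part x - w.
  apply: pos_part_le; last by rewrite vle_subr_ge0.
  rewrite -[X in X <=v _]pos_part_subr; apply: vle_add (vle_refl _) _.
  by rewrite vleN2.
by rewrite vle_subl_self.
Qed.

(** Both x and y dominate x - (z - y), which is therefore negative. *)
Lemma disjoint_add_le x y z :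
  0 <=v x -> 0 <=v y -> disjoint x y -> x <=v z -> y <=v z -> x + y <=v z.
Proof.
move=> x0 y0 xy xz yz; rewrite -[z]add0r -vleBlDr.
apply: disjoint_le xy _ _; rewrite modulus_id// vleBlDr.
  exact: vle_add (vle_refl _) yz.
by rewrite addrC; apply: vle_add (vle_refl _) xz.
Qed.

Lemma disjoint_complement_ideal x : is_ideal (fun y => disjoint y x).
Proof.
split=> [|y z|c y|y z]; [exact: disjoint0|exact: disjointD|exact: disjointZ|].
exact: disjoint_solid.
Qed.

(** Closure under suprema is the only point beyond [disjoint_complement_ideal].
    The negative part of the supremum s of S is dominated by that of any
    element of S. A positive w below both s^+ and |x| is disjoint from the
    elements of S, so s - w still bounds S and w must be 0. *)
Lemma disjoint_complement_band x : is_band (fun y => disjoint y x).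
Proof.
split=> [|S s Sx [sub slub]]; first exact: disjoint_complement_ideal.
rewrite -(pos_part_subr s); apply: disjointB.
  apply: disjoint_intro => w w0; rewrite modulus_id ?pos_part_ge0// => ws wx.
  suff : s <=v s - w by rewrite vle_subl_self.
  apply: slub => y Sy.
  have wy : w + pos_part y <=v pos_part s.
    apply: disjoint_add_le (pos_part_ge0 y) _ ws _ => //.
      apply: disjoint_sym; apply: (disjoint_solid (y := y)).
        by rewrite modulus_id ?pos_part_ge0// pos_part_modulus.
      apply: disjoint_sym; apply: disjoint_solid (disjoint_sym (Sx _ Sy)).
      by rewrite modulus_id.
    apply: pos_part_le (pos_part_ge0 s).
    by apply: vle_trans (pos_part_ge s); apply: sub.
  have sy : neg_part s <=v neg_part y.
    apply: neg_part_le (neg_part_ge0 y).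
    by apply: vle_trans (vle_supl (- y) 0); rewrite vleN2; apply: sub.
  rewrite vleBrDr addrC.
  have : - neg_part y <=v - neg_part s by rewrite vleN2.
  by move/(vle_add wy); rewrite -addrA !pos_part_subr.
have [S0|/set0P[y Sy]] := eqVneq S set0.
  (* Every vector bounds the empty set, so s is a least element of X. *)
  have : s <=v s - neg_part s by apply: slub => y; rewrite S0.
  rewrite vle_subl_self => n0.
  by rewrite (vle_eq n0 (neg_part_ge0 s)); apply: disjoint0.
apply: (disjoint_solid (y := y)); last exact: Sx.
rewrite modulus_id ?neg_part_ge0//; apply: vle_trans (neg_part_modulus y).
apply: neg_part_le (neg_part_ge0 y).
by apply: vle_trans (vle_supl (- y) 0); rewrite vleN2; apply: sub.
Qed.

End VectorLatticeTheory.

(** * Coordinates of atoms *)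

Section AtomCoordinates.
Context {R : realType} {X : banachLatticeType R}.
Implicit Types (a b s u v w x y z : X) (c d k t : R).

Lemma lattice_norm_le x y : 0 <=v x -> x <=v y -> `|x| <= `|y|.
Proof.
move=> x0 xy; apply: norm_le_modulus; rewrite !modulus_id//.
exact: vle_trans xy.
Qed.

(** The Archimedean property, which the norm provides: the positive part of x
    has norm at most e * |y| for all e. *)
Lemma norm_archimedean x y :
  0 <=v y -> (forall e : R, 0 < e -> x <=v e *: y) -> x <=v 0.
Proof.
move=> y0 h; apply: vle_trans (pos_part_ge x) _.
suff -> : pos_part x = 0 by exact: vle_refl.
apply/eqP; rewrite -normr_le0; apply/ler_addgt0Pl => e e0; rewrite addr0.
have k0 : 0 < e / (1 + `|y|) by rewrite divr_gt0// ltr_pwDl.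
have /(lattice_norm_le (pos_part_ge0 x)) : pos_part x <=v (e / (1 + `|y|)) *: y.
  by apply: pos_part_le (h _ k0) _; apply: vscale_ge0 => //; apply: ltW.
move=> /le_trans; apply; rewrite normrZ gtr0_norm// -mulrA ler_piMr ?(ltW e0)//.
by rewrite mulrC ler_pdivrMr ?mul1r ?lerDr// ltr_pwDl.
Qed.

Lemma atom_neq0 a : is_atom a -> a != 0. Proof. by case. Qed.
Lemma atom_ge0 a : is_atom a -> 0 <=v a. Proof. by case. Qed.

Lemma atom_span a x : is_atom a -> 0 <=v x -> x <=v a -> exists c, x = c *: a.
Proof.
move=> [_ a0 aE] x0 xa.
have : principal_ideal a x by exists 1 => //; rewrite scale1r !modulus_id.
by rewrite aE => -[c _ <-]; exists c.
Qed.

Lemma atom_scale_ge0 a c : is_atom a -> 0 <=v c *: a -> 0 <= c.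
Proof.
move=> aA ca; rewrite leNgt; apply/negP => c0.
by move/eqP: (atom_neq0 aA); apply; apply: vscale_lt0_eq0 ca => //; apply: atom_ge0.
Qed.

(** Testing disjointness on the single vector a suffices, because I_a is
    spanned by a. *)
Lemma is_band_projection_atom a x c : is_atom a ->
  is_band_projection (principal_ideal a) x (c *: a) <-> disjoint (x - c *: a) a.
Proof.
move=> [_ a0 aE]; split=> [[_]|xca].
  by apply; exists 1 => //; rewrite scale1r vle_refl.
rewrite aE; split=> [|_ [t _ <-]]; first by exists c.
exact/disjoint_sym/disjointZ/disjoint_sym.
Qed.

Lemma disjoint_atom_unique a x c d : is_atom a ->
  disjoint (x - c *: a) a -> disjoint (x - d *: a) a -> c = d.
Proof.
move=> aA xc xd; apply/eqP; rewrite -subr_eq0; apply: contraT => cd.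
have /(disjointZ (c - d)^-1) : disjoint ((c - d) *: a) a.
  rewrite scalerBl; have -> : c *: a - d *: a = x - d *: a - (x - c *: a).
    by rewrite opprB [RHS]addrC addrA subrK.
  exact: disjointB.
rewrite scalerA mulVf// scale1r => /disjoint_self a0.
by move: (atom_neq0 aA); rewrite a0 eqxx.
Qed.

Lemma coordE a x c : is_atom a -> disjoint (x - c *: a) a -> coord a x = c.
Proof.
move=> aA xc; apply: get_unique => [|d].
  exact/is_band_projection_atom.
by move=> /(is_band_projection_atom _ _ aA) /disjoint_atom_unique; apply.
Qed.

(** For x >= 0 the coordinate is the largest c with c a <= x. The set of these c
    is bounded by |x| / |a| and contains its supremum by the Archimedean
    property; and a non-zero positive vector below both x - c a and a would be
    a positive multiple of a, which contradicts maximality. *)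
Lemma coord_exists_pos a x : is_atom a -> 0 <=v x ->
  exists c, [/\ 0 <= c, c *: a <=v x & disjoint (x - c *: a) a].
Proof.
move=> aA x0; have a0 := atom_ge0 aA.
have na : 0 < `|a| by rewrite normr_gt0 atom_neq0.
pose E := [set c : R | c *: a <=v x].
have E0 : E 0 by rewrite /E /= scale0r.
have ubE : has_ubound E.
  exists (`|x| / `|a|) => c Ec; rewrite ler_pdivlMr//.
  have [c0|c0] := leP 0 c; last first.
    by apply: le_trans (normr_ge0 x); rewrite mulr_le0_ge0 ?ltW.
  rewrite -[c in c * _]ger0_norm// -normrZ.
  by apply: lattice_norm_le => //; apply: vscale_ge0.
have c0 : 0 <= sup E by apply: ub_le_sup.
have cx : sup E *: a <=v x.
  rewrite -[x]addr0 addrC -vleBlDr; apply: (norm_archimedean a0) => e e0.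
  have [k Ek ek] := sup_adherent e0 (conj (ex_intro _ _ E0) ubE).
  rewrite vleBlDr addrC -vleBlDr -scalerBl; apply: vle_trans Ek.
  by apply: vle_scale_coef => //; apply: ltW.
exists (sup E); split => //; apply: disjoint_intro => w w0.
rewrite !modulus_id ?vle_subr_ge0// => wx wa.
have [t wE] := atom_span aA w0 wa.
have t0 : t <= 0.
  rewrite -(lerD2l (sup E)) addr0; apply: ub_le_sup => //.
  by rewrite /E /= scalerDl addrC -vleBrDr -wE.
by rewrite wE -[X in _ <=v X](scale0r a); apply: vle_scale_coef.
Qed.

Lemma coord_disjoint a x : is_atom a -> disjoint (x - coord a x *: a) a.
Proof.
move=> aA.
have [c [_ _ xc]] := coord_exists_pos aA (pos_part_ge0 x).
have [d [_ _ xd]] := coord_exists_pos aA (neg_part_ge0 x).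
suff h : disjoint (x - (c - d) *: a) a by rewrite (coordE aA h).
rewrite -[X in X - _]pos_part_subr scalerBl opprD addrACA -opprD.
exact: disjointB.
Qed.

Lemma coord_ge0 a x : is_atom a -> 0 <=v x -> 0 <= coord a x.
Proof.
by move=> aA x0; have [c [c0 _ /(coordE aA) ->]] := coord_exists_pos aA x0.
Qed.

Lemma coord_scale_le a x : is_atom a -> 0 <=v x -> coord a x *: a <=v x.
Proof.
by move=> aA x0; have [c [_ ? /(coordE aA) ->]] := coord_exists_pos aA x0.
Qed.

Lemma coordB a x y : is_atom a -> coord a (x - y) = coord a x - coord a y.
Proof.
move=> aA; apply: (coordE aA); rewrite scalerBl opprD addrACA -opprD.
by apply: disjointB; apply: coord_disjoint.
Qed.

Lemma coordZ a c x : is_atom a -> coord a (c *: x) = c * coord a x.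
Proof.
move=> aA; apply: (coordE aA); rewrite -scalerA -scalerBr.
exact/disjointZ/coord_disjoint.
Qed.

Lemma coord0 a : is_atom a -> coord a 0 = 0.
Proof. by move=> aA; rewrite -(scale0r a) coordZ// mul0r. Qed.

Lemma coordD a x y : is_atom a -> coord a (x + y) = coord a x + coord a y.
Proof.
move=> aA; rewrite -{1}[y]opprK coordB// -[- y]sub0r coordB// coord0//.
by rewrite sub0r opprK.
Qed.

Lemma coord_self a : is_atom a -> coord a a = 1.
Proof.
move=> aA; apply: (coordE aA); rewrite scale1r subrr; exact: disjoint0.
Qed.

Lemma coord_eq0 a x : is_atom a -> disjoint x a -> coord a x = 0.
Proof. by move=> aA xa; apply: (coordE aA); rewrite scale0r subr0. Qed.

Lemma coord_le a x y : is_atom a -> x <=v y -> coord a x <= coord a y.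
Proof.
by move=> aA xy; rewrite -subr_ge0 -coordB// coord_ge0// vle_subr_ge0.
Qed.

End AtomCoordinates.

(** * The representation in R^A *)

Section Representation.
Context {R : realType} {X : banachLatticeType R} (A : set X).
Context (X_atomic : atomic X) (A_maximal : maximal_disjoint_atoms A).
Implicit Types (a b s u v w x y z : X) (c d k t : R).

Lemma maximal_atom a : A a -> is_atom a.
Proof. by case: A_maximal => -[h _] _; apply: h. Qed.

Lemma coord_maximal_atoms a b : A a -> A b -> coord b a = (a == b)%:R.
Proof.
move=> Aa Ab; have [<-|/eqP ab] := eqVneq a b; first exact/coord_self/maximal_atom.
apply: coord_eq0; first exact: maximal_atom.
by case: A_maximal => -[_ h] _; apply: h.
Qed.

(** By maximality an atom that is not a multiple of an element of A belongs to
    A, so the disjoint complement of x is a band containing every atom. *)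
Lemma disjoint_maximal_atoms_eq0 x : (forall a, A a -> disjoint a x) -> x = 0.
Proof.
move=> xA; apply: disjoint_self.
suff: [set: X] `<=` (fun y => disjoint y x) by apply.
rewrite -X_atomic; apply: smallest_sub; first exact: disjoint_complement_band.
move=> b bA.
have [[a Aa ab]|h] := pselect (exists2 a, A a & ~ disjoint b a); last first.
  apply: (xA b); have [[AA AD] Amax] := A_maximal.
  rewrite -(Amax (A `|` [set b])); [by right| |by left].
  have bD a : A a -> disjoint b a.
    by move=> Aa; apply: contrapT => ba; apply: h; exists a.
  split=> [a [/AA//|->//]|a c [Aa|->] [Ac|->] ac //].
  - exact: AD.
  - exact/disjoint_sym/bD.
  - exact: bD.
have aA := maximal_atom Aa.
have [w [w0 wb wa wN]] : exists w, [/\ 0 <=v w, w <=v b, w <=v a & ~ w <=v 0].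
  apply: contrapT => nw; apply: ab; apply: disjoint_intro => w w0.
  rewrite !modulus_id ?atom_ge0// => wb wa.
  by apply: contrapT => w1; apply: nw; exists w.
have [t wta] := atom_span aA w0 wa.
have [r wrb] := atom_span bA w0 wb.
have r0 : r != 0.
  by apply/eqP => r0; apply: wN; rewrite wrb r0 scale0r vle_refl.
suff -> : b = (r^-1 * t) *: a by apply/disjointZ/xA.
by rewrite -scalerA -wta wrb scalerA mulVf// scale1r.
Qed.

(** The representation reflects the order: if the coordinates of x are positive
    then, at an atom a where x^- has the coordinate d, both x^+ and x^-
    dominate d a, and they are disjoint; so x^- vanishes. *)
Lemma coord_reflect_ge0 x : (forall a, A a -> 0 <= coord a x) -> 0 <=v x.
Proof.
move=> x0; suff n0 : neg_part x = 0.
  by rewrite -(pos_part_subr x) n0 subr0 pos_part_ge0.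
have nx0 := neg_part_ge0 x.
apply: disjoint_maximal_atoms_eq0 => a Aa; have aA := maximal_atom Aa.
have a0 := atom_ge0 aA.
have d0 := coord_ge0 aA nx0.
suff c0 : coord a (neg_part x) = 0.
  by have := coord_disjoint (neg_part x) aA; rewrite c0 scale0r subr0 => /disjoint_sym.
have dx : coord a (neg_part x) <= coord a (pos_part x).
  by rewrite -subr_ge0 -coordB// pos_part_subr x0.
apply/eqP; rewrite eq_le d0 andbT -oppr_ge0; apply: (atom_scale_ge0 aA).
rewrite scaleNr -oppr0 vleN2; apply: disjoint_le (disjoint_pos_neg x) _ _.
  rewrite modulus_id ?pos_part_ge0//.
  apply: vle_trans (coord_scale_le aA (pos_part_ge0 x)).
  exact: vle_scale_coef.
by rewrite modulus_id ?coord_scale_le.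
Qed.

Lemma coord_reflect_le x y :
  (forall a, A a -> coord a x <= coord a y) -> x <=v y.
Proof.
move=> xy; rewrite -vle_subr_ge0; apply: coord_reflect_ge0 => a Aa.
by rewrite coordB ?subr_ge0 ?xy//; apply: maximal_atom.
Qed.

Lemma coord_inj x y : (forall a, A a -> coord a x = coord a y) -> x = y.
Proof. by move=> xy; apply: vle_eq; apply: coord_reflect_le => a /xy ->. Qed.

(** The image of X in R^A is an ideal: z is the supremum of the vectors f(a) a.
    If a coordinate of z exceeded f(a), then lowering that coordinate to f(a)
    would give a smaller upper bound. *)
Lemma coord_solid (f : X -> R) x : order_complete X ->
  (forall a, A a -> 0 <= f a <= coord a x) ->
  exists z, forall a, A a -> coord a z = f a.
Proof.
move=> X_complete fx.
have x0 : 0 <=v x.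
  by apply: coord_reflect_ge0 => a /fx /andP[]; apply: le_trans.
pose S : set X := [set z | z = 0 \/ exists2 a, A a & z = f a *: a].
have S0 : S !=set0 by exists 0; left.
have coordS z a : S z -> A a -> coord a z <= f a.
  move=> Sz Aa; have aA := maximal_atom Aa.
  have /andP[f0 _] := fx a Aa.
  case: Sz => [->|[b Ab ->]]; first by rewrite coord0.
  rewrite coordZ// coord_maximal_atoms//; have [->|_] := eqVneq b a.
    by rewrite mulr1.
  by rewrite mulr0.
have Sx : upper_bound S !=set0.
  exists x => z Sz; apply: coord_reflect_le => a Aa.
  by apply: le_trans (coordS z a Sz Aa) _; have /andP[] := fx a Aa.
have [z [zub zlub]] := X_complete S S0 Sx.
have fz a : A a -> f a <= coord a z.
  move=> Aa; have aA := maximal_atom Aa.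
  have /(coord_le aA) : f a *: a <=v z by apply: zub; right; exists a.
  by rewrite coordZ// coord_self// mulr1.
exists z => a Aa; have aA := maximal_atom Aa.
pose d := coord a z - f a.
suff : z <=v z - d *: a.
  move=> /(coord_le aA); rewrite coordB// coordZ// coord_self// mulr1 /d.
  by rewrite opprB addrC subrK => za; apply/eqP; rewrite eq_le za fz.
apply: zlub => y Sy; apply: coord_reflect_le => b Ab.
apply: le_trans (coordS y b Sy Ab) _; have bA := maximal_atom Ab.
rewrite coordB// coordZ// (coord_maximal_atoms Aa Ab); have [<-|_] := eqVneq a b.
  by rewrite mulr1 /d opprB addrC subrK.
by rewrite mulr0 subr0 fz.
Qed.

End Representation.

(** * Convergence of real nets *)

Section NetConvergence.
Context {R : realType} (D : directedSet).

Global Instance tails_filter : Filter (tails D).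
Proof.
have [i0] := dinhab D.
split=> [|P Q [i iP] [j jQ]|P Q PQ [i iP]].
- by exists i0.
- have [k ik jk] := dle_ub i j; exists k => l kl.
  by split; [apply: iP|apply: jQ]; apply: dle_trans kl.
- by exists i => j /iP /PQ.
Qed.

Lemma tails_cvg0P (f : D -> R) :
  f i @[i --> tails D] --> (0 : R) <->
  forall e : R, 0 < e -> exists i, forall j, dle i j -> `|f j| <= e.
Proof. by split=> [/cvgr0Pnorm_le//|h]; apply/cvgr0Pnorm_le. Qed.

End NetConvergence.

(** * Pointwise and un-convergence *)

Section UnboundedConvergence.
Context {R : realType} {X : banachLatticeType R} (A : set X).
Context (X_atomic : atomic X) (A_maximal : maximal_disjoint_atoms A).
Implicit Types (D : directedSet).

Lemma atomic_reprE (x : X) (f : A -> R) (a : A) :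
  atomic_repr A x = f -> coord (val a) x = f a.
Proof. by move=> <-. Qed.

Lemma maximal_val (a : A) : A (val a).
Proof. exact: set_valP. Qed.

(** Tested on the vector a, un-convergence bounds min(|y_i(a)|, 1) |a| by the
    norm of a vector that tends to 0. *)
Lemma un_cvg0_pointwise D (y : D -> A -> R) :
  un_cvg y (fun=> 0) -> pointwise_cvg y (fun=> 0).
Proof.
move=> un_y a; have aA := maximal_atom A_maximal (maximal_val a).
have a0 := atom_ge0 aA.
have na : 0 < `|val a| by rewrite normr_gt0 atom_neq0.
have [z zE z0] := un_y _ a0.
have zge i : Num.min `|y i a| 1 * `|val a| <= `|z i|.
  have zi b : A b -> 0 <= coord b (z i).
    move=> Ab; have /(congr1 (fun h => h (exist _ b (mem_set Ab)))) := zE i.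
    rewrite /atomic_repr /= => ->; rewrite le_min normr_ge0 /=.
    by apply: coord_ge0 => //; apply: maximal_atom Ab.
  have {}zi := coord_reflect_ge0 X_atomic A_maximal zi.
  have := coord_scale_le aA zi.
  rewrite (atomic_reprE _ (zE i)) /= subr0 /atomic_repr coord_self// => h.
  have m0 : 0 <= Num.min `|y i a| 1 by rewrite le_min normr_ge0 ler01.
  rewrite -[X in X * _ <= _]ger0_norm// -normrZ.
  by apply: lattice_norm_le h; apply: vscale_ge0.
apply/tails_cvg0P => e e0; move/tails_cvg0P: z0.
(* A bound of 1/2 on min(|y_j(a)|, 1) excludes that the minimum is 1. *)
have m0 : 0 < Num.min e (2^-1) by rewrite lt_min e0 invr_gt0 ltr0n.
move=> /(_ (Num.min e 2^-1 * `|val a|)) [|i hi]; first exact: mulr_gt0.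
exists i => j /hi; rewrite normr_id => /(le_trans (zge j)).
rewrite ler_pM2r// le_min !ge_min => /andP[/orP[//|e1] /orP[y2|]]; last first.
  by rewrite leNgt invf_lt1 ?ltr1n.
apply: le_trans y2 _; apply: le_trans e1.
by rewrite invf_le1 ?ler1n.
Qed.

(** A decreasing net x_i with infimum 0 decreases to 0 in every coordinate a: if
    all coordinates were above e > 0, then e a would be a lower bound. Since
    x_i = x_i /\ x_j for i >= j, testing un-convergence on a single x_j recovers
    norm convergence. *)
Lemma pointwise_un_cvg_order_continuous :
  (forall D (y : D -> A -> R),
    pointwise_cvg y (fun=> 0) -> un_cvg y (fun=> 0)) ->
  order_continuous X.
Proof.
move=> ptw_un D x xdecr [xge0 xinf].
have x0 i : 0 <=v x i by apply: xge0; exists i.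
have ptw : pointwise_cvg (fun i => atomic_repr A (x i)) (fun=> 0).
  move=> a; have aA := maximal_atom A_maximal (maximal_val a).
  apply/tails_cvg0P => e e0.
  have [i xie] : exists i, coord (val a) (x i) <= e.
    apply: contrapT => h.
    have : e *: val a <=v 0.
      apply: xinf => _ [i _ <-]; apply: vle_trans (coord_scale_le aA (x0 i)).
      apply: vle_scale_coef; first exact: atom_ge0.
      by rewrite leNgt; apply/negP => /ltW xe; apply: h; exists i.
    move=> /(coord_le aA); rewrite coordZ// coord_self// mulr1 coord0//.
    by rewrite leNgt e0.
  exists i => j ij; rewrite ger0_norm; last exact: coord_ge0.
  by apply: le_trans xie; apply: coord_le => //; apply: xdecr.
have [i0] := dinhab D.
have [z zE z0] := ptw_un D _ ptw _ (x0 i0).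
have zx j : dle i0 j -> z j = x j.
  move=> ij; apply: (coord_inj X_atomic A_maximal) => a Aa.
  have aA := maximal_atom A_maximal Aa.
  rewrite -[a]/(val (exist _ a (mem_set Aa) : A)) (atomic_reprE _ (zE j)) /=.
  rewrite subr0 ger0_norm ?coord_ge0//; apply/min_idPl.
  by apply: coord_le => //; apply: xdecr.
apply/tails_cvg0P => e e0; move/tails_cvg0P: z0 => /(_ e e0) [i hi].
have [k ik i0k] := dle_ub i i0; exists k => j kj.
by rewrite -zx; [apply: hi; apply: dle_trans kj|apply: dle_trans kj].
Qed.

(** A list stands for the set of its entries, so that repetitions have to be
    removed in [partial_sum]. *)
Definition finite_subsets : directedSet.
Proof.
refine (@DirectedSet (seq A) (fun s t => {subset s <= t}) (inhabits [::]) _ _ _).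
- by move=> s a.
- by move=> s t u st tu a /st /tu.
- move=> s t; exists (s ++ t) => a; rewrite mem_cat => -> //.
  by rewrite orbT.
Defined.

Definition partial_sum (f : A -> R) (s : seq A) : X :=
  \sum_(a <- undup s) f a *: val a.

Lemma coord_partial_sum (f : A -> R) s (b : A) :
  coord (val b) (partial_sum f s) = if b \in s then f b else 0.
Proof.
have bA := maximal_atom A_maximal (maximal_val b).
rewrite /partial_sum -mem_undup.
elim: (undup s) (undup_uniq s) => [_|a r ih /= /andP[ar /ih{}ih]].
  by rewrite big_nil coord0.
rewrite big_cons coordD// coordZ// ih.
rewrite (coord_maximal_atoms A_maximal (maximal_val a) (maximal_val b)).
rewrite in_cons (inj_eq val_inj); have [<-|_] := eqVneq a b.
  by rewrite (negPf ar) mulr1 addr0.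
by rewrite mulr0 add0r.
Qed.

(** The finite sections x_s of x >= 0 increase to x, so |x - x_s| is small for
    some s by order continuity. As |y_i| /\ x is below (x - x_s) plus the
    section at s of |y_i|, pointwise convergence on s finishes the estimate. *)
Lemma order_continuous_pointwise_un_cvg : order_complete X ->
  order_continuous X ->
  forall D (y : D -> A -> R),
    pointwise_cvg y (fun=> 0) -> un_cvg y (fun=> 0).
Proof.
move=> X_complete X_cont D y ptw x x0.
have AA (a : A) := maximal_atom A_maximal (maximal_val a).
have xc (a : A) : 0 <= atomic_repr A x a by apply: coord_ge0.
pose m i (a : A) := Num.min `|y i a| (atomic_repr A x a).
have m0 i a : 0 <= m i a by rewrite le_min normr_ge0 xc.
have [z zE] : exists z : D -> X, forall i a, coord (val a) (z i) = m i a.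
  suff /choice[z zE] : forall i, exists w, forall a : A, coord (val a) w = m i a.
    by exists z.
  move=> i.
  pose f (b : X) := if pselect (A b) is left Ab
    then m i (exist _ b (mem_set Ab)) else 0.
  have fE (a : A) : f (val a) = m i a.
    rewrite /f; case: pselect => [Ab|[]]; last exact: maximal_val.
    by congr (m i _); apply: val_inj.
  have [|w wE] :=
      coord_solid X_atomic A_maximal (f := f) (x := x) X_complete.
    move=> a Aa; rewrite -[a]/(val (exist _ a (mem_set Aa) : A)) fE m0 /=.
    by rewrite ge_min lexx orbT.
  by exists w => a; rewrite wE ?fE//; apply: maximal_val.
have reflect_le u v :
    (forall a : A, coord (val a) u <= coord (val a) v) -> u <=v v.
  move=> uv; apply: (coord_reflect_le X_atomic A_maximal) => a Aa.
  exact: (uv (exist _ a (mem_set Aa))).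
pose xs (s : finite_subsets) := x - partial_sum (atomic_repr A x) s.
have xsE s a : coord (val a) (xs s) = if a \in s then 0 else atomic_repr A x a.
  rewrite /xs coordB// coord_partial_sum; case: ifP => _; last by rewrite subr0.
  exact: subrr.
have xs0 s : 0 <=v xs s.
  by apply: reflect_le => a; rewrite coord0// xsE; case: ifP.
have xs_cvg : `|xs s| @[s --> tails finite_subsets] --> (0 : R).
  apply: X_cont => [s t st|].
    apply: reflect_le => a; rewrite !xsE; case: ifP => [_|ta]; first by case: ifP.
    by case: ifP => // /st; rewrite ta.
  split=> [_ [s _ <-]//|w wlb]; apply: reflect_le => a; rewrite coord0//.
  have /(coord_le (AA a)) : w <=v xs [:: a] by apply: wlb; exists [:: a].
  by rewrite xsE mem_head.
exists z.
  by move=> i; apply: funext => a; rewrite [LHS]zE /m subr0.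
have zle i s : `|z i| <= `|xs s| + \sum_(a <- undup s) `|y i a| * `|val a|.
  have z0 : 0 <=v z i by apply: reflect_le => a; rewrite coord0// zE.
  have : z i <=v xs s + partial_sum (fun a => `|y i a|) s.
    apply: reflect_le => a; rewrite coordD// zE xsE coord_partial_sum.
    by case: ifP => _; rewrite ?add0r ?addr0 ge_min lexx ?orbT.
  move=> /(lattice_norm_le z0) /le_trans; apply.
  apply: le_trans (ler_normD _ _) _; rewrite lerD2l.
  apply: le_trans (ler_norm_sum _ _ _) _; apply: ler_sum => a _.
  by rewrite normrZ normr_id.
have sum_cvg s :
    \sum_(a <- undup s) `|y i a| * `|val a| @[i --> tails D] --> (0 : R).
  rewrite [X in _ --> X](_ : _ = \sum_(a <- undup s) 0); last by rewrite big1.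
  apply: cvg_big => [|a _]; first exact: add_continuous.
  rewrite -(mul0r `|val a|); apply: cvgM; last exact: cvg_cst.
  by rewrite -(@normr0 _ R); apply: cvg_norm; apply: ptw.
apply/tails_cvg0P => e e0.
have e2 : 0 < e / 2 by rewrite divr_gt0.
move/tails_cvg0P: xs_cvg => /(_ _ e2)[s /(_ s (dle_refl s)) xse].
move/tails_cvg0P: (sum_cvg s) => /(_ _ e2)[i hi].
exists i => j /hi ye; rewrite normr_id; apply: le_trans (zle j s) _.
rewrite [e]splitr; apply: lerD.
  by move: xse; rewrite normr_id.
exact: le_trans (ler_norm _) ye.
Qed.

End UnboundedConvergence.

Theorem proposition4p1 (R : realType) (X : banachLatticeType R) (A : set X)
    (X_complete : order_complete X) (X_atomic : atomic X)
    (A_maximal : maximal_disjoint_atoms A) :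
  (forall (D : directedSet) (y : D -> A -> R),
     un_cvg y (fun=> 0) -> pointwise_cvg y (fun=> 0)) /\
  ((forall (D : directedSet) (y : D -> A -> R),
      pointwise_cvg y (fun=> 0) -> un_cvg y (fun=> 0)) <->
   order_continuous X).
Proof.
split; first by move=> D y; apply: un_cvg0_pointwise.
split; first exact: pointwise_un_cvg_order_continuous.
by move=> X_cont D y; apply: order_continuous_pointwise_un_cvg.
Qed.
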